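(* If $c:(\vdash\Gamma)$ is derivable in the type system $\mathrm{MAL}\omega$, then the command $c$ normalizes for $\to_0\,=\,\to_\beta\cup\to_\mu$ using at most $|c|$ $\to_\beta$-steps, where $|c|$ is the size of $c$.
   Context: **Terms.** There are positive variables $x,y,\dots$ and negative variables $\alpha,\beta,\dots$; $\kappa,\kappa'$ denote variables of either polarity. The syntax may contain constants $k_+\in\mathcal K_+$, $k_-\in\mathcal K_-$ (which have no typing rule). Grammar: positive values $V_+::=x\mid (V,V')\mid\{V\}\mid k_+$; values $V::=V_+\mid t_-$; positive terms $t_+::=V_+\mid\mu\alpha.c$; negative terms $t_-::=\alpha\mid\mu(\kappa,\kappa').c\ (\kappa\ne\kappa')\mid\mu\{\kappa\}.c\mid\mu x.c\mid k_-$; commands $c::=\langle t_+|t_-\rangle$, where $\langle t|u\rangle$ and $\langle u|t\rangle$ are identified. Everything is up to $\alpha$-equivalence. $|c|$ is the size (number of symbols) of $c$. **Reduction** (on whole commands, not under binders): $\langle\mu\alpha.c|t_-\rangle\to_\mu c[t_-/\alpha]$; $\langle V_+|\mu x.c\rangle\to_\mu c[V_+/x]$; $\langle\{V\}|\mu\{\kappa\}.c\rangle\to_\beta c[V/\kappa]$; $\langle(V,V')|\mu(\kappa,\kappa').c\rangle\to_\beta c[V/\kappa,V'/\kappa']$ (the $\to_\beta$ rules only if polarities of variables and values match). **Kinds and constructors.** Kinds: $\sigma,\tau::=\iota\mid o^+\mid o^-\mid\sigma\to\tau$. Constructors: $T,U,A,B::=x^\tau\mid(x^\tau)^\bot\mid\lambda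 x^\tau.T\mid TU\mid\mathbf 0\mid\mathbf s\mid rec_\tau\mid rec_\tau^\bot\mid A\otimes B\mid A\wp B\mid\exists x^\tau.A\mid\forall x^\tau.A\mid\downarrow A\mid\uparrow A$. Binders bind both $x^\tau$ and $(x^\tau)^\bot$; substituting $U$ for $x^\tau$ replaces $(x^\tau)^\bot$ by $U^\bot$. Negation on kinds: $(o^+)^\bot=o^-$, $(o^-)^\bot=o^+$, $\iota^\bot=\iota$, $(\sigma\to\tau)^\bot=\sigma\to\tau^\bot$. Involutive negation on constructors: it exchanges $x^\tau$ and $(x^\tau)^\bot$, $rec_\tau$ and $rec_\tau^\bot$; $\mathbf 0^\bot=\mathbf 0$, $\mathbf s^\bot=\mathbf s$, $(\lambda x.T)^\bot=\lambda x.T^\bot$, $(TU)^\bot=T^\bot U$, $(A\otimes B)^\bot=A^\bot\wp B^\bot$, $(A\wp B)^\bot=A^\bot\otimes B^\bot$, $(\forall x.A)^\bot=\exists x.A^\bot$, $(\exists x.A)^\bot=\forall x.A^\bot$, $(\uparrow A)^\bot=\downarrow A^\bot$, $(\downarrow A)^\bot=\uparrow A^\bot$. Kinding: $x^\tau:\tau$; $(x^\tau)^\bot:\tau^\bot$; $\lambda x^\sigma.T:\sigma\to\tau$ if $T:\tau$; $TU:\tau$ if $T:\sigma\to\tau,U:\sigma$; $\mathbf 0:\iota$; $\mathbf s:\iota\to\iota$; $rec_\tau:\tau\to(\iota\to\tau\to\tau)\to\iota\to\tau$; $rec_\tau^\bot:\tau\to(\iota\to\tau\to\tau)\to\iota\to\tau^\bot$;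 for $A,B$ of kind $o^+$ or $o^-$: $A\otimes B:o^+$, $\downarrow A:o^+$, $A\wp B:o^-$, $\uparrow A:o^-$; $\forall x^\tau.A$ and $\exists x^\tau.A$ have the same kind $o^{+}$ or $o^-$ as $A$. Formulas are constructors of kind $o^+$ (positive, $P$) or $o^-$ (negative, $N$). Convertibility $\cong$ is the least equivalence relation containing $(\lambda x.T)U\cong T\{x:=U\}$; $\lambda x.Tx\cong T$ ($x$ not free in $T$); $rec_\tau T U\mathbf 0\cong T$; $rec_\tau TU(\mathbf s n)\cong U n(rec_\tau TUn)$; $rec_\tau^\bot TU\mathbf 0\cong T^\bot$; $rec_\tau^\bot TU(\mathbf sn)\cong U^\bot n(rec_\tau TUn)$; and closed under $\lambda$, application, $\otimes$, $\wp$, $\exists$, $\forall$. **Typing rules of $\mathrm{MAL}\omega$.** Contexts $\Gamma,\Delta$ are finite sets of declarations $x:N$ (positive variable, negative formula) or $\alpha:P$ (negative variable, positive formula). Judgments: $\vdash t_+:P\mid\Gamma$, $\vdash t_-:N\mid\Gamma$, $c:(\vdash\Gamma)$. Rules (premises $\Rightarrow$ conclusion): $(Ax_+)$ $\vdash x:P\mid x:P^\bot$; $(Ax_-)$ $\vdash\alpha:N\mid\alpha:N^\bot$; $(\mu_+)$ $c:(\vdash\alpha:P,\Gamma)\Rightarrow\ \vdash\mu\alpha.c:P\mid\Gamma$; $(\mu_-)$ $c:(\vdash x:N,\Gamma)\Rightarrow\ \vdash\mu x.c:N\mid\Gamma$; $(Cut)$ $\vdash t:A\mid\Gamma$ and $\vdash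 u:A^\bot\mid\Delta\Rightarrow\langle t|u\rangle:(\vdash\Gamma,\Delta)$; $(\otimes)$ $\vdash V:A\mid\Gamma$ and $\vdash V':B\mid\Delta\Rightarrow\ \vdash(V,V'):A\otimes B\mid\Gamma,\Delta$; $(\wp)$ $c:(\vdash\kappa:A,\kappa':B,\Gamma)\Rightarrow\ \vdash\mu(\kappa,\kappa').c:A\wp B\mid\Gamma$; $(\downarrow)$ $\vdash V:A\mid\Gamma\Rightarrow\ \vdash\{V\}:\downarrow A\mid\Gamma$; $(\uparrow)$ $c:(\vdash\kappa:A,\Gamma)\Rightarrow\ \vdash\mu\{\kappa\}.c:\uparrow A\mid\Gamma$; $(\exists)$ $\vdash t:A[T/x^\tau]\mid\Gamma$ with $T:\tau\Rightarrow\ \vdash t:\exists x^\tau.A\mid\Gamma$; $(\forall)$ $\vdash V:A\mid\Gamma$ with $x^\tau$ not in $\Gamma\Rightarrow\ \vdash V:\forall x^\tau.A\mid\Gamma$; $(\cong)$ $c:(\vdash\kappa:A,\Gamma)$ with $A\cong B\Rightarrow c:(\vdash\kappa:B,\Gamma)$; $(W)$ $c:(\vdash\Gamma)\Rightarrow c:(\vdash\kappa:A,\Gamma)$. In two-premise rules $\Gamma$ and $\Delta$ are disjoint (so every typable term is affine: each bound variable occurs at most once). *)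

(* Defs.v *)
From HB Require Import structures.
From mathcomp Require Import all_boot.
From mathcomp Require Import finmap.

Set Implicit Arguments.
Unset Strict Implicit.
Unset Printing Implicit Defensive.

Local Open Scope fset_scope.
Local Open Scope fmap_scope.

(* Alpha-equivalence is handled by the locally nameless representation, both
   for terms and for constructors: a free variable is a name and a bound
   variable is a de Bruijn index, so that Leibniz equality is alpha-equivalence.
   The raw binders have capitalised names; the lower case functions [mu_neg],
   [mu_pos], [mu_pair], [mu_box], [clam], [cex], [call] bind a *named* variable,
   and the rules are stated with them. *)

Inductive polarity := Pos | Neg.

Definition bool_of_polarity p := if p is Pos then true else false.
Definition polarity_of_bool b := if b then Pos else Neg.
Lemma bool_of_polarityK : cancel bool_of_polarity polarity_of_bool.
Proof. by case. Qed.
HB.instance Definition _ := Countable.copy polarity (can_type bool_of_polarityK).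

Definition opp (p : polarity) := if p is Pos then Neg else Pos.

(* Variables of terms: [(Pos, x)] is the positive variable x, [(Neg, a)] is the
   negative variable alpha. *)
Definition var : Type := (polarity * nat)%type.

(** * Terms *)

(* Positive and negative bound variables are indexed separately: in [PBound i],
   [i] counts only the enclosing binders of positive variables, and in
   [NBound i] only those of negative variables.  In [MuPair p p' c] the binder
   of polarity [p'] is the inner one. *)
Inductive pvalue (Kp Kn : Type) : Type :=
| PFree of nat
| PBound of nat
| Pair of value Kp Kn & value Kp Kn
| Box of value Kp Kn
| PConst of Kp
with value (Kp Kn : Type) : Type :=
| ValP of pvalue Kp Kn
| ValN of nterm Kp Kn
with pterm (Kp Kn : Type) : Type :=
| TmVal of pvalue Kp Kn
| MuNeg of command Kp Kn
with nterm (Kp Kn : Type) : Type :=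
| NFree of nat
| NBound of nat
| MuPair of polarity & polarity & command Kp Kn
| MuBox of polarity & command Kp Kn
| MuPos of command Kp Kn
| NConst of Kn
with command (Kp Kn : Type) : Type :=
| Cmd of pterm Kp Kn & nterm Kp Kn.

Arguments PFree {Kp Kn} _.
Arguments PBound {Kp Kn} _.
Arguments PConst {Kp Kn} _.
Arguments NFree {Kp Kn} _.
Arguments NBound {Kp Kn} _.
Arguments NConst {Kp Kn} _.

Inductive term (Kp Kn : Type) : Type :=
| TermP of pterm Kp Kn
| TermN of nterm Kp Kn.

Section Terms.
Context {Kp Kn : Type}.

Definition term_of_value (V : value Kp Kn) : term Kp Kn :=
  match V with
  | ValP v => TermP (TmVal v)
  | ValN u => TermN u
  end.

Definition value_polarity (V : value Kp Kn) : polarity :=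
  match V with ValP _ => Pos | ValN _ => Neg end.

(* One symbol for each variable occurrence, each constant and each syntactic
   construct; the inclusions between syntactic categories, and the binding
   occurrences of variables, are not counted. *)
Fixpoint size_pvalue (v : pvalue Kp Kn) : nat :=
  match v with
  | PFree _ | PBound _ | PConst _ => 1
  | Pair V V' => (size_value V + size_value V').+1
  | Box V => (size_value V).+1
  end
with size_value (V : value Kp Kn) : nat :=
  match V with
  | ValP v => size_pvalue v
  | ValN u => size_nterm u
  end
with size_pterm (t : pterm Kp Kn) : nat :=
  match t with
  | TmVal v => size_pvalue v
  | MuNeg c => (size_command c).+1
  end
with size_nterm (u : nterm Kp Kn) : nat :=
  match u with
  | NFree _ | NBound _ | NConst _ => 1
  | MuPair _ _ c | MuBox _ c | MuPos c => (size_command c).+1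
  end
with size_command (c : command Kp Kn) : nat :=
  match c with
  | Cmd t u => (size_pterm t + size_nterm u).+1
  end.

(* [close_* k j e] replaces the free variable [k] by the bound variable of the
   same polarity and index [j].  Crossing a binder shifts [j] only if this
   binder has the polarity of [k]. *)
Fixpoint close_pvalue (k : var) (j : nat) (v : pvalue Kp Kn) : pvalue Kp Kn :=
  match v with
  | PFree x => if k == (Pos, x) then PBound j else PFree x
  | PBound i => PBound i
  | Pair V V' => Pair (close_value k j V) (close_value k j V')
  | Box V => Box (close_value k j V)
  | PConst a => PConst a
  end
with close_value (k : var) (j : nat) (V : value Kp Kn) : value Kp Kn :=
  match V with
  | ValP v => ValP (close_pvalue k j v)
  | ValN u => ValN (close_nterm k j u)
  end
with close_pterm (k : var) (j : nat) (t : pterm Kp Kn) : pterm Kp Kn :=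
  match t with
  | TmVal v => TmVal (close_pvalue k j v)
  | MuNeg c => MuNeg (close_command k (j + (Neg == k.1)) c)
  end
with close_nterm (k : var) (j : nat) (u : nterm Kp Kn) : nterm Kp Kn :=
  match u with
  | NFree x => if k == (Neg, x) then NBound j else NFree x
  | NBound i => NBound i
  | MuPair p p' c =>
      MuPair p p' (close_command k (j + (p == k.1) + (p' == k.1)) c)
  | MuBox p c => MuBox p (close_command k (j + (p == k.1)) c)
  | MuPos c => MuPos (close_command k (j + (Pos == k.1)) c)
  | NConst a => NConst a
  end
with close_command (k : var) (j : nat) (c : command Kp Kn) : command Kp Kn :=
  match c with
  | Cmd t u => Cmd (close_pterm k j t) (close_nterm k j u)
  end.

Definition mu_neg (a : nat) (c : command Kp Kn) : pterm Kp Kn :=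
  MuNeg (close_command (Neg, a) 0 c).

Definition mu_pos (x : nat) (c : command Kp Kn) : nterm Kp Kn :=
  MuPos (close_command (Pos, x) 0 c).

Definition mu_box (k : var) (c : command Kp Kn) : nterm Kp Kn :=
  MuBox k.1 (close_command k 0 c).

(* If [k] and [k'] have the same polarity, their indices are 1 and 0; if not,
   both have index 0 in their respective index space. *)
Definition mu_pair (k k' : var) (c : command Kp Kn) : nterm Kp Kn :=
  MuPair k.1 k'.1 (close_command k' 0 (close_command k (k'.1 == k.1) c)).

(* [open_* W j e] replaces the bound variable with the polarity of [W] and index
   [j] by [W].  There is no lifting of [W]: reduction applies only to whole
   commands, so the substituted values have no dangling index. *)
Fixpoint open_pvalue (W : value Kp Kn) (j : nat) (v : pvalue Kp Kn) :
    pvalue Kp Kn :=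
  match v with
  | PFree x => PFree x
  | PBound i => if W is ValP w then if i == j then w else PBound i else PBound i
  | Pair V V' => Pair (open_value W j V) (open_value W j V')
  | Box V => Box (open_value W j V)
  | PConst a => PConst a
  end
with open_value (W : value Kp Kn) (j : nat) (V : value Kp Kn) : value Kp Kn :=
  match V with
  | ValP v => ValP (open_pvalue W j v)
  | ValN u => ValN (open_nterm W j u)
  end
with open_pterm (W : value Kp Kn) (j : nat) (t : pterm Kp Kn) : pterm Kp Kn :=
  match t with
  | TmVal v => TmVal (open_pvalue W j v)
  | MuNeg c => MuNeg (open_command W (j + (Neg == value_polarity W)) c)
  end
with open_nterm (W : value Kp Kn) (j : nat) (u : nterm Kp Kn) : nterm Kp Kn :=
  match u with
  | NFree x => NFree x
  | NBound i => if W is ValN w then if i == j then w else NBound i else NBound i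
  | MuPair p p' c =>
      MuPair p p' (open_command W
        (j + (p == value_polarity W) + (p' == value_polarity W)) c)
  | MuBox p c => MuBox p (open_command W (j + (p == value_polarity W)) c)
  | MuPos c => MuPos (open_command W (j + (Pos == value_polarity W)) c)
  | NConst a => NConst a
  end
with open_command (W : value Kp Kn) (j : nat) (c : command Kp Kn) :
    command Kp Kn :=
  match c with
  | Cmd t u => Cmd (open_pterm W j t) (open_nterm W j u)
  end.

(** * Reduction *)

Inductive red_mu : command Kp Kn -> command Kp Kn -> Prop :=
| red_mu_neg c u : red_mu (Cmd (MuNeg c) u) (open_command (ValN u) 0 c)
| red_mu_pos v c : red_mu (Cmd (TmVal v) (MuPos c)) (open_command (ValP v) 0 c).

Inductive red_beta : command Kp Kn -> command Kp Kn -> Prop :=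
| red_beta_box V p c :
    value_polarity V = p ->
    red_beta (Cmd (TmVal (Box V)) (MuBox p c)) (open_command V 0 c)
| red_beta_pair V V' p p' c :
    value_polarity V = p -> value_polarity V' = p' ->
    red_beta (Cmd (TmVal (Pair V V')) (MuPair p p' c))
             (open_command V' 0 (open_command V (p' == p) c)).

Definition red0 (c c' : command Kp Kn) : Prop := red_beta c c' \/ red_mu c c'.

Definition normal (c : command Kp Kn) : Prop := ~ exists c', red0 c c'.

(* [red0_seq n c c']: there is a sequence of [red0]-steps from [c] to [c'],
   exactly [n] of which are [red_beta]-steps. *)
Inductive red0_seq : nat -> command Kp Kn -> command Kp Kn -> Prop :=
| red0_seq_refl c : red0_seq 0 c c
| red0_seq_mu n c1 c2 c3 :
    red_mu c1 c2 -> red0_seq n c2 c3 -> red0_seq n c1 c3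
| red0_seq_beta n c1 c2 c3 :
    red_beta c1 c2 -> red0_seq n c2 c3 -> red0_seq n.+1 c1 c3.

End Terms.

(** * Kinds and constructors *)

Inductive kind :=
| KIota
| KO of polarity
| KArr of kind & kind.

Lemma kind_eq_dec : comparable kind.
Proof. by rewrite /comparable /decidable; decide equality; apply: eq_comparable. Qed.
HB.instance Definition _ := hasDecEq.Build kind (compareP kind_eq_dec).

Fixpoint kneg (tau : kind) : kind :=
  match tau with
  | KIota => KIota
  | KO p => KO (opp p)
  | KArr sigma tau' => KArr sigma (kneg tau')
  end.

(* In [CFree], [CBound] and [CRec] the boolean tells whether the variable or
   recursor is negated: [CFree false x tau] is x^tau, [CFree true x tau] is
   (x^tau)^bot.  A variable is determined by its name and its kind. *)
Inductive ctor :=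
| CFree of bool & nat & kind
| CBound of bool & nat
| CLam of kind & ctor
| CApp of ctor & ctor
| CZero
| CSucc
| CRec of bool & kind
| CTensor of ctor & ctor
| CPar of ctor & ctor
| CEx of kind & ctor
| CAll of kind & ctor
| CDown of ctor
| CUp of ctor.

Fixpoint cneg (T : ctor) : ctor :=
  match T with
  | CFree b x tau => CFree (~~ b) x tau
  | CBound b i => CBound (~~ b) i
  | CLam tau T' => CLam tau (cneg T')
  | CApp T' U => CApp (cneg T') U
  | CZero => CZero
  | CSucc => CSucc
  | CRec b tau => CRec (~~ b) tau
  | CTensor A B => CPar (cneg A) (cneg B)
  | CPar A B => CTensor (cneg A) (cneg B)
  | CEx tau A => CAll tau (cneg A)
  | CAll tau A => CEx tau (cneg A)
  | CDown A => CUp (cneg A)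
  | CUp A => CDown (cneg A)
  end.

(* [clc 0 T] (local closure): [T] has no dangling index, i.e. it stands for an
   actual constructor up to alpha-equivalence. *)
Fixpoint clc (j : nat) (T : ctor) : bool :=
  match T with
  | CBound _ i => i < j
  | CFree _ _ _ | CZero | CSucc | CRec _ _ => true
  | CLam _ T' | CEx _ T' | CAll _ T' => clc j.+1 T'
  | CApp T' U | CTensor T' U | CPar T' U => clc j T' && clc j U
  | CDown A | CUp A => clc j A
  end.

Fixpoint cclose (x : nat) (tau : kind) (j : nat) (T : ctor) : ctor :=
  match T with
  | CFree b y sigma =>
      if (y == x) && (sigma == tau) then CBound b j else CFree b y sigma
  | CLam sigma T' => CLam sigma (cclose x tau j.+1 T')
  | CEx sigma A => CEx sigma (cclose x tau j.+1 A)
  | CAll sigma A => CAll sigma (cclose x tau j.+1 A)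
  | CApp T' U => CApp (cclose x tau j T') (cclose x tau j U)
  | CTensor A B => CTensor (cclose x tau j A) (cclose x tau j B)
  | CPar A B => CPar (cclose x tau j A) (cclose x tau j B)
  | CDown A => CDown (cclose x tau j A)
  | CUp A => CUp (cclose x tau j A)
  | CBound _ _ | CZero | CSucc | CRec _ _ => T
  end.

Definition clam (x : nat) (tau : kind) (T : ctor) := CLam tau (cclose x tau 0 T).
Definition cex (x : nat) (tau : kind) (A : ctor) := CEx tau (cclose x tau 0 A).
Definition call (x : nat) (tau : kind) (A : ctor) := CAll tau (cclose x tau 0 A).

(* [csubst x tau U T] is T[U/x^tau]; it is capture-avoiding if [U] is locally
   closed. *)
Fixpoint csubst (x : nat) (tau : kind) (U T : ctor) : ctor :=
  match T with
  | CFree b y sigma =>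
      if (y == x) && (sigma == tau) then (if b then cneg U else U)
      else CFree b y sigma
  | CLam sigma T' => CLam sigma (csubst x tau U T')
  | CEx sigma A => CEx sigma (csubst x tau U A)
  | CAll sigma A => CAll sigma (csubst x tau U A)
  | CApp T' T'' => CApp (csubst x tau U T') (csubst x tau U T'')
  | CTensor A B => CTensor (csubst x tau U A) (csubst x tau U B)
  | CPar A B => CPar (csubst x tau U A) (csubst x tau U B)
  | CDown A => CDown (csubst x tau U A)
  | CUp A => CUp (csubst x tau U A)
  | CBound _ _ | CZero | CSucc | CRec _ _ => T
  end.

Fixpoint cfree (x : nat) (tau : kind) (T : ctor) : bool :=
  match T with
  | CFree _ y sigma => (y == x) && (sigma == tau)
  | CLam _ T' | CEx _ T' | CAll _ T' => cfree x tau T'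
  | CApp T' U | CTensor T' U | CPar T' U => cfree x tau T' || cfree x tau U
  | CDown A | CUp A => cfree x tau A
  | CBound _ _ | CZero | CSucc | CRec _ _ => false
  end.

Definition krec (tau res : kind) : kind :=
  KArr tau (KArr (KArr KIota (KArr tau tau)) (KArr KIota res)).

(* There is no rule for [CBound]: only locally closed constructors have a kind. *)
Inductive kinded : ctor -> kind -> Prop :=
| kd_var x tau : kinded (CFree false x tau) tau
| kd_nvar x tau : kinded (CFree true x tau) (kneg tau)
| kd_lam x sigma tau T : kinded T tau -> kinded (clam x sigma T) (KArr sigma tau)
| kd_app sigma tau T U :
    kinded T (KArr sigma tau) -> kinded U sigma -> kinded (CApp T U) tau
| kd_zero : kinded CZero KIota
| kd_succ : kinded CSucc (KArr KIota KIota)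
| kd_rec tau : kinded (CRec false tau) (krec tau tau)
| kd_nrec tau : kinded (CRec true tau) (krec tau (kneg tau))
| kd_tensor p q A B :
    kinded A (KO p) -> kinded B (KO q) -> kinded (CTensor A B) (KO Pos)
| kd_par p q A B :
    kinded A (KO p) -> kinded B (KO q) -> kinded (CPar A B) (KO Neg)
| kd_ex x tau p A : kinded A (KO p) -> kinded (cex x tau A) (KO p)
| kd_all x tau p A : kinded A (KO p) -> kinded (call x tau A) (KO p)
| kd_down p A : kinded A (KO p) -> kinded (CDown A) (KO Pos)
| kd_up p A : kinded A (KO p) -> kinded (CUp A) (KO Neg).

(* The premises [clc 0 _] make [conv] a relation between actual constructors.
   There is no congruence rule for [CDown] and [CUp]. *)
Inductive conv : ctor -> ctor -> Prop :=
| conv_beta x tau T U : clc 0 T -> clc 0 U ->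
    conv (CApp (clam x tau T) U) (csubst x tau U T)
| conv_eta x tau T : clc 0 T -> ~~ cfree x tau T ->
    conv (clam x tau (CApp T (CFree false x tau))) T
| conv_rec0 tau T U : clc 0 T -> clc 0 U ->
    conv (CApp (CApp (CApp (CRec false tau) T) U) CZero) T
| conv_recS tau T U n : clc 0 T -> clc 0 U -> clc 0 n ->
    conv (CApp (CApp (CApp (CRec false tau) T) U) (CApp CSucc n))
         (CApp (CApp U n) (CApp (CApp (CApp (CRec false tau) T) U) n))
| conv_nrec0 tau T U : clc 0 T -> clc 0 U ->
    conv (CApp (CApp (CApp (CRec true tau) T) U) CZero) (cneg T)
| conv_nrecS tau T U n : clc 0 T -> clc 0 U -> clc 0 n ->
    conv (CApp (CApp (CApp (CRec true tau) T) U) (CApp CSucc n))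
         (CApp (CApp (cneg U) n) (CApp (CApp (CApp (CRec false tau) T) U) n))
| conv_refl T : clc 0 T -> conv T T
| conv_sym T U : conv T U -> conv U T
| conv_trans T U W : conv T U -> conv U W -> conv T W
| conv_lam x tau T T' : conv T T' -> conv (clam x tau T) (clam x tau T')
| conv_app T T' U U' : conv T T' -> conv U U' -> conv (CApp T U) (CApp T' U')
| conv_tensor A A' B B' :
    conv A A' -> conv B B' -> conv (CTensor A B) (CTensor A' B')
| conv_par A A' B B' : conv A A' -> conv B B' -> conv (CPar A B) (CPar A' B')
| conv_ex x tau A A' : conv A A' -> conv (cex x tau A) (cex x tau A')
| conv_all x tau A A' : conv A A' -> conv (call x tau A) (call x tau A').

(** * Typing *)

Definition ctx := {fmap var -> ctor}.

(* The formula declared for a variable has the opposite polarity. *)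
Definition declarable (k : var) (A : ctor) : Prop := kinded A (KO (opp k.1)).

(* [has_type t A G] is |- t : A | G and [derivable c G] is c : (|- G).
   The side conditions [kinded _ _] and [declarable _ _] occur in the rules that
   introduce new formulas; they entail that in every derivable judgment a
   positive (resp. negative) term has a positive (resp. negative) formula, and
   that every declaration satisfies [declarable].  As <t|u> and <u|t> are
   identified and [cneg] is involutive, the cut rule is stated with the positive
   term first. *)
Inductive has_type (Kp Kn : Type) : term Kp Kn -> ctor -> ctx -> Prop :=
| ty_ax_pos x P :
    kinded P (KO Pos) ->
    has_type (TermP (TmVal (PFree x))) P [fmap].[(Pos, x) <- cneg P]
| ty_ax_neg a N :
    kinded N (KO Neg) ->
    has_type (TermN (NFree a)) N [fmap].[(Neg, a) <- cneg N]
| ty_mu_neg a c P (G : ctx) :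
    (Neg, a) \notin domf G ->
    derivable c G.[(Neg, a) <- P] ->
    has_type (TermP (mu_neg a c)) P G
| ty_mu_pos x c N (G : ctx) :
    (Pos, x) \notin domf G ->
    derivable c G.[(Pos, x) <- N] ->
    has_type (TermN (mu_pos x c)) N G
| ty_tensor V V' A B (G D : ctx) :
    [disjoint domf G & domf D] ->
    has_type (term_of_value V) A G ->
    has_type (term_of_value V') B D ->
    has_type (TermP (TmVal (Pair V V'))) (CTensor A B) (G + D)
| ty_par k k' c A B (G : ctx) :
    k != k' -> k \notin domf G -> k' \notin domf G ->
    derivable c G.[k' <- B].[k <- A] ->
    has_type (TermN (mu_pair k k' c)) (CPar A B) G
| ty_down V A (G : ctx) :
    has_type (term_of_value V) A G ->
    has_type (TermP (TmVal (Box V))) (CDown A) G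
| ty_up k c A (G : ctx) :
    k \notin domf G ->
    derivable c G.[k <- A] ->
    has_type (TermN (mu_box k c)) (CUp A) G
| ty_ex t x tau p T A (G : ctx) :
    kinded T tau -> kinded A (KO p) ->
    has_type t (csubst x tau T A) G ->
    has_type t (cex x tau A) G
| ty_all V x tau A (G : ctx) :
    (forall k B, G.[? k] = Some B -> ~~ cfree x tau B) ->
    has_type (term_of_value V) A G ->
    has_type (term_of_value V) (call x tau A) G
with derivable (Kp Kn : Type) : command Kp Kn -> ctx -> Prop :=
| ty_cut t u A (G D : ctx) :
    [disjoint domf G & domf D] ->
    has_type (TermP t) A G ->
    has_type (TermN u) (cneg A) D ->
    derivable (Cmd t u) (G + D)
| ty_conv c k A B (G : ctx) :
    k \notin domf G -> conv A B -> declarable k B ->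
    derivable c G.[k <- A] ->
    derivable c G.[k <- B]
| ty_weak c k A (G : ctx) :
    k \notin domf G -> declarable k A ->
    derivable c G ->
    derivable c G.[k <- A].

(* Main.v *)
Require Import Defs.
From mathcomp Require Import all_boot.
From mathcomp Require Import finmap.
From mathcomp Require Import zify.

(** A typable command is affine and has no dangling index, since the contexts
    of the premises of a two-premise rule are disjoint.  Contracting a redex of
    an affine command replaces at most one occurrence of each bound variable by
    a closed affine value which the redex itself provides, so the reduct is
    again affine and closed, and strictly smaller.  Hence every reduction
    sequence from [c] has at most [size_command c] steps in all, whether
    [red_mu] or [red_beta]. *)

(* Mutual induction over syntax and over derivations *)
Scheme pvalue_mut := Induction for pvalue Sort Prop
with value_mut := Induction for value Sort Prop
with pterm_mut := Induction for pterm Sort Prop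
with nterm_mut := Induction for nterm Sort Prop
with command_mut := Induction for command Sort Prop.
Combined Scheme syntax_ind
  from pvalue_mut, value_mut, pterm_mut, nterm_mut, command_mut.

Scheme has_type_mut := Minimality for has_type Sort Prop
with derivable_mut := Minimality for derivable Sort Prop.
Combined Scheme typing_ind from has_type_mut, derivable_mut.

(** * Occurrence counts and affinity *)

Section Occurrences.
Context {Kp Kn : Type}.

(** Here [i] is the index as seen at the root, so it shifts under binders exactly as in [close_*]
    and [open_*]. Counting occurrences lets one function express both affinity (at most 1) and
    closedness (0 everywhere). *)
Fixpoint bocc_pvalue (p : polarity) (i : nat) (v : pvalue Kp Kn) : nat :=
  match v with
  | PFree _ | PConst _ => 0
  | PBound j => (p == Pos) && (j == i)
  | Pair V V' => bocc_value p i V + bocc_value p i V'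
  | Box V => bocc_value p i V
  end
with bocc_value (p : polarity) (i : nat) (V : value Kp Kn) : nat :=
  match V with
  | ValP v => bocc_pvalue p i v
  | ValN u => bocc_nterm p i u
  end
with bocc_pterm (p : polarity) (i : nat) (t : pterm Kp Kn) : nat :=
  match t with
  | TmVal v => bocc_pvalue p i v
  | MuNeg c => bocc_command p (i + (Neg == p)) c
  end
with bocc_nterm (p : polarity) (i : nat) (u : nterm Kp Kn) : nat :=
  match u with
  | NFree _ | NConst _ => 0
  | NBound j => (p == Neg) && (j == i)
  | MuPair q q' c => bocc_command p (i + (q == p) + (q' == p)) c
  | MuBox q c => bocc_command p (i + (q == p)) c
  | MuPos c => bocc_command p (i + (Pos == p)) c
  end
with bocc_command (p : polarity) (i : nat) (c : command Kp Kn) : nat :=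
  match c with
  | Cmd t u => bocc_pterm p i t + bocc_nterm p i u
  end.

Fixpoint focc_pvalue (k : var) (v : pvalue Kp Kn) : nat :=
  match v with
  | PFree x => k == (Pos, x)
  | PBound _ | PConst _ => 0
  | Pair V V' => focc_value k V + focc_value k V'
  | Box V => focc_value k V
  end
with focc_value (k : var) (V : value Kp Kn) : nat :=
  match V with
  | ValP v => focc_pvalue k v
  | ValN u => focc_nterm k u
  end
with focc_pterm (k : var) (t : pterm Kp Kn) : nat :=
  match t with
  | TmVal v => focc_pvalue k v
  | MuNeg c => focc_command k c
  end
with focc_nterm (k : var) (u : nterm Kp Kn) : nat :=
  match u with
  | NFree a => k == (Neg, a)
  | NBound _ | NConst _ => 0
  | MuPair _ _ c | MuBox _ c | MuPos c => focc_command k c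
  end
with focc_command (k : var) (c : command Kp Kn) : nat :=
  match c with
  | Cmd t u => focc_pterm k t + focc_nterm k u
  end.

Fixpoint affine_pvalue (v : pvalue Kp Kn) : bool :=
  match v with
  | PFree _ | PBound _ | PConst _ => true
  | Pair V V' => affine_value V && affine_value V'
  | Box V => affine_value V
  end
with affine_value (V : value Kp Kn) : bool :=
  match V with
  | ValP v => affine_pvalue v
  | ValN u => affine_nterm u
  end
with affine_pterm (t : pterm Kp Kn) : bool :=
  match t with
  | TmVal v => affine_pvalue v
  | MuNeg c => (bocc_command Neg 0 c <= 1) && affine_command c
  end
with affine_nterm (u : nterm Kp Kn) : bool :=
  match u with
  | NFree _ | NBound _ | NConst _ => true
  | MuPair p p' c =>
      (* The inner binder [p'] owns index 0; it pushes the outer one to index 1 exactly when the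
         polarities agree. *)
      [&& bocc_command p (p' == p) c <= 1, bocc_command p' 0 c <= 1
        & affine_command c]
  | MuBox p c => (bocc_command p 0 c <= 1) && affine_command c
  | MuPos c => (bocc_command Pos 0 c <= 1) && affine_command c
  end
with affine_command (c : command Kp Kn) : bool :=
  match c with
  | Cmd t u => affine_pterm t && affine_nterm u
  end.

(** * Binding a named variable *)

(** Closing turns each free occurrence of [k] into one of index [j] and renumbers nothing, so the
    two counts add up. *)
Lemma bocc_close :
  (forall v k j p i, bocc_pvalue p i (close_pvalue k j v) =
    bocc_pvalue p i v + ((p == k.1) && (i == j)) * focc_pvalue k v) /\
  (forall V k j p i, bocc_value p i (close_value k j V) =
    bocc_value p i V + ((p == k.1) && (i == j)) * focc_value k V) /\
  (forall t k j p i, bocc_pterm p i (close_pterm k j t) =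
    bocc_pterm p i t + ((p == k.1) && (i == j)) * focc_pterm k t) /\
  (forall u k j p i, bocc_nterm p i (close_nterm k j u) =
    bocc_nterm p i u + ((p == k.1) && (i == j)) * focc_nterm k u) /\
  (forall c k j p i, bocc_command p i (close_command k j c) =
    bocc_command p i c + ((p == k.1) && (i == j)) * focc_command k c).
Proof.
(* A binder shifts the counted index and the closing index by the same amount when their polarities
   agree; otherwise both sides are false. *)
have shift (f : polarity -> nat) (p p' : polarity) (i j : nat) :
    (p == p') && (i + f p == j + f p') = (p == p') && (i == j).
  by case: eqP => //= ->; rewrite eqn_add2r.
apply syntax_ind => //=.
- move=> x k j p i; case: eqP => [->|_] /=; last by rewrite muln0.
  by rewrite muln1 eq_sym (eq_sym j).
- by move=> *; rewrite muln0 addn0.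
- by move=> V IH V' IH' k j p i; rewrite IH IH' mulnDr addnACA.
- by move=> *; rewrite muln0.
- move=> c IH k j p i; rewrite IH; congr (_ + nat_of_bool _ * _).
  exact: (shift (fun q => Neg == q)).
- move=> a k j p i; case: eqP => [->|_] /=; last by rewrite muln0.
  by rewrite muln1 eq_sym (eq_sym j).
- by move=> *; rewrite muln0 addn0.
- move=> q q' c IH k j p i; rewrite IH; congr (_ + nat_of_bool _ * _).
  rewrite -!addnA; exact: (shift (fun r => (q == r) + (q' == r))).
- move=> q c IH k j p i; rewrite IH; congr (_ + nat_of_bool _ * _).
  exact: (shift (fun r => q == r)).
- move=> c IH k j p i; rewrite IH; congr (_ + nat_of_bool _ * _).
  exact: (shift (fun r => Pos == r)).
- by move=> *; rewrite muln0.
- by move=> t IH u IH' k j p i; rewrite IH IH' mulnDr addnACA.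
Qed.

Lemma bocc_close_command c k j p i :
  bocc_command p i (close_command k j c) =
  bocc_command p i c + ((p == k.1) && (i == j)) * focc_command k c.
Proof. by case: bocc_close => _ [_ [_ [_ ->]]]. Qed.

Lemma focc_close :
  (forall v k j k', focc_pvalue k' (close_pvalue k j v) =
    (k' != k) * focc_pvalue k' v) /\
  (forall V k j k', focc_value k' (close_value k j V) =
    (k' != k) * focc_value k' V) /\
  (forall t k j k', focc_pterm k' (close_pterm k j t) =
    (k' != k) * focc_pterm k' t) /\
  (forall u k j k', focc_nterm k' (close_nterm k j u) =
    (k' != k) * focc_nterm k' u) /\
  (forall c k j k', focc_command k' (close_command k j c) =
    (k' != k) * focc_command k' c).
Proof.
apply syntax_ind => //=; try by move=> *; rewrite muln0.
- move=> x k j k'; case: (eqVneq k) => [->|kx] /=; first by case: eqP.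
  by case: (eqVneq k') => [->|_]; rewrite ?muln0 // eq_sym kx.
- by move=> V IH V' IH' k j k'; rewrite IH IH' mulnDr.
- move=> x k j k'; case: (eqVneq k) => [->|kx] /=; first by case: eqP.
  by case: (eqVneq k') => [->|_]; rewrite ?muln0 // eq_sym kx.
- by move=> t IH u IH' k j k'; rewrite IH IH' mulnDr.
Qed.

Lemma focc_close_command c k j k' :
  focc_command k' (close_command k j c) = (k' != k) * focc_command k' c.
Proof. by case: focc_close => _ [_ [_ [_ ->]]]. Qed.

(** Below a binder, the closing index of the same polarity has been shifted past the index owned by
    that binder, so the counts that affinity bounds do not change. *)
Lemma affine_close :
  (forall v k j, affine_pvalue (close_pvalue k j v) = affine_pvalue v) /\
  (forall V k j, affine_value (close_value k j V) = affine_value V) /\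
  (forall t k j, affine_pterm (close_pterm k j t) = affine_pterm t) /\
  (forall u k j, affine_nterm (close_nterm k j u) = affine_nterm u) /\
  (forall c k j, affine_command (close_command k j c) = affine_command c).
Proof.
apply syntax_ind => //=.
- by move=> x k j; case: ifP.
- by move=> V IH V' IH' k j; rewrite IH IH'.
- move=> c IH k j; rewrite IH bocc_close_command.
  by case: k => -[] x /=; rewrite ?addn1 addn0.
- by move=> x k j; case: ifP.
- move=> q q' c IH k j; rewrite IH !bocc_close_command.
  by case: q; case: q'; case: k => -[] x /=; rewrite ?addn1 ?addn0.
- move=> q c IH k j; rewrite IH bocc_close_command.
  by case: q; case: k => -[] x /=; rewrite ?addn1 addn0.
- move=> c IH k j; rewrite IH bocc_close_command.
  by case: k => -[] x /=; rewrite ?addn1 addn0.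
- by move=> t IH u IH' k j; rewrite IH IH'.
Qed.

Lemma affine_close_command c k j :
  affine_command (close_command k j c) = affine_command c.
Proof. by case: affine_close => _ [_ [_ [_ ->]]]. Qed.

(** * Substitution of closed values *)

Definition closed_value (V : value Kp Kn) := forall p i, bocc_value p i V = 0.
Definition closed_command (c : command Kp Kn) :=
  forall p i, bocc_command p i c = 0.

(** Each of the [n] replaced occurrences has size 1 and gives way to a copy of [W]; adding [n] on
    the left avoids truncated subtraction. *)
Lemma size_open W :
  (forall v j, let n := bocc_pvalue (value_polarity W) j v in
    size_pvalue (open_pvalue W j v) + n = size_pvalue v + n * size_value W) /\
  (forall V j, let n := bocc_value (value_polarity W) j V in
    size_value (open_value W j V) + n = size_value V + n * size_value W) /\
  (forall t j, let n := bocc_pterm (value_polarity W) j t in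
    size_pterm (open_pterm W j t) + n = size_pterm t + n * size_value W) /\
  (forall u j, let n := bocc_nterm (value_polarity W) j u in
    size_nterm (open_nterm W j u) + n = size_nterm u + n * size_value W) /\
  (forall c j, let n := bocc_command (value_polarity W) j c in
    size_command (open_command W j c) + n =
    size_command c + n * size_value W).
Proof.
apply syntax_ind => //=.
- by move=> i j; case: W => //= w; case: eqP => //= _; lia.
- by move=> V IH V' IH' j; have := IH j; have := IH' j; lia.
- by move=> V IH j; have := IH j; lia.
- by move=> c IH j; rewrite !addSn IH.
- by move=> i j; case: W => //= w; case: eqP => //= _; lia.
- by move=> q q' c IH j; rewrite !addSn IH.
- by move=> q c IH j; rewrite !addSn IH.
- by move=> c IH j; rewrite !addSn IH.
- by move=> t IH u IH' j; have := IH j; have := IH' j; lia.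
Qed.

Lemma size_open_command W c j :
  bocc_command (value_polarity W) j c <= 1 ->
  size_command (open_command W j c) <= size_command c + size_value W.
Proof.
case: (size_open W) => _ [_ [_ [_ /(_ c j)]]] /=.
by case: bocc_command => [|[|//]]; lia.
Qed.

(** The copies of [W] contribute no bound occurrence, and opening does not renumber: the count of
    the opened index drops to 0 and all others stay. *)
Lemma bocc_open W : closed_value W ->
  (forall v j p i, bocc_pvalue p i (open_pvalue W j v) =
    ~~ ((p == value_polarity W) && (i == j)) * bocc_pvalue p i v) /\
  (forall V j p i, bocc_value p i (open_value W j V) =
    ~~ ((p == value_polarity W) && (i == j)) * bocc_value p i V) /\
  (forall t j p i, bocc_pterm p i (open_pterm W j t) =
    ~~ ((p == value_polarity W) && (i == j)) * bocc_pterm p i t) /\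
  (forall u j p i, bocc_nterm p i (open_nterm W j u) =
    ~~ ((p == value_polarity W) && (i == j)) * bocc_nterm p i u) /\
  (forall c j p i, bocc_command p i (open_command W j c) =
    ~~ ((p == value_polarity W) && (i == j)) * bocc_command p i c).
Proof.
move=> cW.
have shift (f : polarity -> nat) (p p' : polarity) (i j : nat) :
    (p == p') && (i + f p == j + f p') = (p == p') && (i == j).
  by case: eqP => //= ->; rewrite eqn_add2r.
apply syntax_ind => //=; try by move=> *; rewrite muln0.
- move=> n j p i; case: W cW => [w|u] cW /=; last by case: p; rewrite ?muln0 ?mul1n.
  have {}cW : bocc_pvalue p i w = 0 := cW p i.
  case: eqP => [->|nj] /=; first by rewrite cW; case: p {cW} => /=; lia.
  by case: p {cW} => /=; lia.
- by move=> V IH V' IH' j p i; rewrite IH IH' mulnDr.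
- move=> c IH j p i; rewrite IH; congr (~~ _ * _).
  exact: (shift (fun q => Neg == q)).
- move=> n j p i; case: W cW => [w|u] cW /=; first by case: p; rewrite ?muln0 ?mul1n.
  have {}cW : bocc_nterm p i u = 0 := cW p i.
  case: eqP => [->|nj] /=; first by rewrite cW; case: p {cW} => /=; lia.
  by case: p {cW} => /=; lia.
- move=> q q' c IH j p i; rewrite IH; congr (~~ _ * _).
  rewrite -!addnA; exact: (shift (fun r => (q == r) + (q' == r))).
- move=> q c IH j p i; rewrite IH; congr (~~ _ * _).
  exact: (shift (fun r => q == r)).
- move=> c IH j p i; rewrite IH; congr (~~ _ * _).
  exact: (shift (fun r => Pos == r)).
- by move=> t IH u IH' j p i; rewrite IH IH' mulnDr.
Qed.

Lemma bocc_open_command W c j p i : closed_value W ->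
  bocc_command p i (open_command W j c) =
  ~~ ((p == value_polarity W) && (i == j)) * bocc_command p i c.
Proof. by case/bocc_open => _ [_ [_ [_ ->]]]. Qed.

(** Opening by a closed value never raises a count, so the bound at each binder survives, and the
    inserted copies are themselves affine. *)
Lemma affine_open W : closed_value W -> affine_value W ->
  (forall v j, affine_pvalue v -> affine_pvalue (open_pvalue W j v)) /\
  (forall V j, affine_value V -> affine_value (open_value W j V)) /\
  (forall t j, affine_pterm t -> affine_pterm (open_pterm W j t)) /\
  (forall u j, affine_nterm u -> affine_nterm (open_nterm W j u)) /\
  (forall c j, affine_command c -> affine_command (open_command W j c)).
Proof.
move=> cW aW.
have bocc_le c j p i n : bocc_command p i c <= n ->
    bocc_command p i (open_command W j c) <= n.
  move=> le_n; rewrite bocc_open_command //.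
  by case: (~~ _); rewrite ?mul1n.
apply syntax_ind => //=.
- by move=> n j _; case: W aW {cW bocc_le} => //= w aw; case: ifP.
- by move=> V IH V' IH' j /andP[aV aV']; rewrite IH // IH'.
- by move=> c IH j /andP[le1 ac]; rewrite bocc_le //= IH.
- by move=> n j _; case: W aW {cW bocc_le} => //= w aw; case: ifP.
- by move=> q q' c IH j /and3P[le1 le1' ac]; rewrite !bocc_le //= IH.
- by move=> q c IH j /andP[le1 ac]; rewrite bocc_le //= IH.
- by move=> c IH j /andP[le1 ac]; rewrite bocc_le //= IH.
- by move=> t IH u IH' j /andP[at' au]; rewrite IH // IH'.
Qed.

Lemma affine_open_command W c j : closed_value W -> affine_value W ->
  affine_command c -> affine_command (open_command W j c).
Proof. by move=> cW /(affine_open _ cW)[_ [_ [_ [_ ao]]]]; apply: ao. Qed.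

(* In a redex on a pair, two binders stand above [c]; [n q] counts those of
   polarity [q] that remain above [c] once the outer one has been opened. *)
Lemma bocc_open_below W c (n : polarity -> nat) : closed_value W ->
  (forall p i, bocc_command p (i + (value_polarity W == p) + n p) c = 0) ->
  forall p i, bocc_command p (i + n p) (open_command W (n (value_polarity W)) c)
              = 0.
Proof.
move=> cW c0 p i; rewrite bocc_open_command // eq_sym.
(* For the polarity of [W], the case [i = 0] is the index just erased, and [i.+1] is covered by the
   hypothesis, where the outer binder still counts. For the other polarity that binder shifts
   nothing. *)
have := c0 p; case: eqP => [<-|_] /= {}c0; last by rewrite -(addn0 i) c0.
case: i => [|i]; first by rewrite eqxx.
by rewrite -addn1 c0 muln0.
Qed.

(** * Reduction and normalization *)

(** The substituted values are parts of the redex, hence closed, affine and already counted in its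
    size. Each is inserted at most once, while the cut and the binder disappear, so the size drops
    strictly. *)
Lemma red0_affine c c' : red0 c c' -> affine_command c -> closed_command c ->
  [/\ affine_command c', closed_command c' & size_command c' < size_command c].
Proof.
case=> [[V p c0 pV|V V' p p' c0 pV pV']|[c0 u|v c0]] /=.
- move=> /and3P[aV le1 a0] cc; subst p.
  have cV : closed_value V by move=> q i; have := cc q i => /=; lia.
  split; first exact: affine_open_command.
  + move=> q i; rewrite -[i]addn0.
    (* With a single binder, none remains above the command once it is opened. *)
    apply: (bocc_open_below _ _ (fun=> 0)) => // {}q {}i; rewrite addn0.
    by have := cc q i => /=; lia.
  + by have := size_open_command _ _ _ le1; lia.
- move=> /andP[/andP[aV aV'] /and3P[le1 le1' a0]] cc; subst p p'.
  have cV : closed_value V by move=> q i; have := cc q i => /=; lia.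
  have cV' : closed_value V' by move=> q i; have := cc q i => /=; lia.
  set c1 := open_command V _ c0.
  have a1 : affine_command c1 by exact: affine_open_command.
  (* Inserting the closed [V] can only remove occurrences of the inner variable, so its bound passes
     from [c0] to [c1]. *)
  have le1c1 : bocc_command (value_polarity V') 0 c1 <= 1.
    by rewrite bocc_open_command //; case: (~~ _); rewrite ?mul1n.
  split; first exact: affine_open_command.
  + move=> q i; rewrite -[i]addn0.
    apply: (bocc_open_below _ _ (fun=> 0)) => // {}q {}i; rewrite addn0.
    (* When [V] is inserted, the inner binder, of the polarity of [V'], still stands above the
       command. *)
    apply: (bocc_open_below _ _ (fun q => value_polarity V' == q)) => // {}q {}i.
    by have := cc q i => /=; lia.
  + have := size_open_command _ _ _ le1'.
    have := size_open_command _ _ _ le1; rewrite -/c1.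
    have := size_open_command _ _ _ le1c1; lia.
- move=> /andP[/andP[le1 a0] au] cc.
  have cu : closed_value (ValN u) by move=> q i; have := cc q i => /=; lia.
  split; first exact: affine_open_command.
  + move=> q i; rewrite -[i]addn0.
    apply: (bocc_open_below _ _ (fun=> 0)) => // {}q {}i; rewrite addn0.
    by have := cc q i => /=; lia.
  + by have := size_open_command (ValN u) _ _ le1 => /=; lia.
- move=> /and3P[av le1 a0] cc.
  have cv : closed_value (ValP v) by move=> q i; have := cc q i => /=; lia.
  split; first exact: affine_open_command.
  + move=> q i; rewrite -[i]addn0.
    apply: (bocc_open_below _ _ (fun=> 0)) => // {}q {}i; rewrite addn0.
    by have := cc q i => /=; lia.
  + by have := size_open_command (ValP v) _ _ le1 => /=; lia.
Qed.

(** Reduction acts only at the root, so the two head constructors decide, together with the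
    polarities for a pair or a box. *)
Lemma red0_or_normal (c : command Kp Kn) : (exists c', red0 c c') \/ normal c.
Proof.
case: c => [[v|c] u]; last by left; eexists; right; apply: red_mu_neg.
case: u => [a|i|p p' c|p c|c|k];
  try by right=> -[c' [] r]; inversion r.
- case: v => [x|i|V V'|V|k]; try by right=> -[c' [] r]; inversion r.
  case: (eqVneq (value_polarity V) p) => [pV|neV]; last first.
    by right=> -[c' [] r]; inversion r; case/eqP: neV.
  case: (eqVneq (value_polarity V') p') => [pV'|neV']; last first.
    by right=> -[c' [] r]; inversion r; case/eqP: neV'.
  by left; eexists; left; apply: red_beta_pair.
- case: v => [x|i|V V'|V|k]; try by right=> -[c' [] r]; inversion r.
  case: (eqVneq (value_polarity V) p) => [pV|neV]; last first.
    by right=> -[c' [] r]; inversion r; case/eqP: neV.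
  by left; eexists; left; apply: red_beta_box.
- by left; eexists; right; apply: red_mu_pos.
Qed.

(** Strong induction on size: a [red_beta]-step adds 1 to [n], paid for by the strict decrease of
    the size; a [red_mu]-step adds nothing. *)
Lemma affine_normalizes c : affine_command c -> closed_command c ->
  exists n c', [/\ red0_seq n c c', normal c' & n <= size_command c].
Proof.
have [m] := ubnP (size_command c); elim: m c => // m IH c; rewrite ltnS => le_m.
move=> ac cc; have [[c1 r]|nc] := red0_or_normal c; last first.
  by exists 0, c; split=> //; apply: red0_seq_refl.
have [ac1 cc1 lt1] := red0_affine _ _ r ac cc.
have [n [c' [rs nc' le_n]]] := IH c1 (leq_trans lt1 le_m) ac1 cc1.
case: r => r; [exists n.+1 | exists n]; exists c'; split=> //.
- exact: red0_seq_beta _ _ _ _ r rs.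
- exact: leq_ltn_trans lt1.
- exact: red0_seq_mu _ _ _ _ r rs.
- exact: leq_trans (ltnW lt1).
Qed.

(** * Affinity of typable commands *)

(** The invariant of typing. Read as 0 or 1, [k \in domf G] says at once that free variables are
    declared and that each occurs at most once. *)
Definition affine_in (affine : bool) (bocc : polarity -> nat -> nat)
    (focc : var -> nat) (G : ctx) :=
  [/\ affine, forall p i, bocc p i = 0 & forall k, focc k <= (k \in domf G)].

Definition pterm_affine_in (t : pterm Kp Kn) :=
  affine_in (affine_pterm t) (fun p i => bocc_pterm p i t)
    (fun k => focc_pterm k t).
Definition nterm_affine_in (u : nterm Kp Kn) :=
  affine_in (affine_nterm u) (fun p i => bocc_nterm p i u)
    (fun k => focc_nterm k u).
Definition value_affine_in (V : value Kp Kn) :=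
  affine_in (affine_value V) (fun p i => bocc_value p i V)
    (fun k => focc_value k V).
Definition command_affine_in (c : command Kp Kn) :=
  affine_in (affine_command c) (fun p i => bocc_command p i c)
    (fun k => focc_command k c).
Definition term_affine_in (t : term Kp Kn) :=
  match t with
  | TermP t => pterm_affine_in t
  | TermN u => nterm_affine_in u
  end.

Lemma term_of_value_affine_in V G :
  term_affine_in (term_of_value V) G -> value_affine_in V G.
Proof. by case: V. Qed.

Lemma in_domf_set (G : ctx) k A k' :
  (k' \in domf G.[k <- A]%fmap) = (k' == k) || (k' \in domf G).
Proof. by rewrite dom_setf in_fset1U. Qed.

(** By disjointness at most one of the two bounds is 1. This is how the splitting of contexts in
    two-premise rules yields affinity. *)
Lemma focc_cat (G D : ctx) (m n : nat) k : [disjoint domf G & domf D]%fset ->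
  m <= (k \in domf G) -> n <= (k \in domf D) ->
  m + n <= (k \in domf (catf G D)).
Proof.
move=> /fdisjointP /(_ k); rewrite domf_cat in_fsetU.
by case: (k \in domf G) => [/(_ isT)/negbTE -> | _]; case: m n => [|m] [|n]; lia.
Qed.

(** A binding rule removes a variable from the context: the bound on its free occurrences becomes
    the bound that affinity requires at the new binder. *)
Lemma typing_affine_in :
  (forall (t : term Kp Kn) A G, has_type t A G -> term_affine_in t G) /\
  (forall (c : command Kp Kn) G, derivable c G -> command_affine_in c G).
Proof.
apply typing_ind => /=.
- by move=> x P _; split=> // k; rewrite in_domf_set /=; case: (k == _).
- by move=> a N _; split=> // k; rewrite in_domf_set /=; case: (k == _).
- move=> a c P G aG _ [ac cc fc]; split=> /=.
  + rewrite affine_close_command ac bocc_close_command cc /= mul1n andbT.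
    by apply: leq_trans (fc _) _; case: (_ \in _).
  (* Closing creates only index 0, whereas from outside the binder an index of its polarity is
     counted as [i + 1]. *)
  + by move=> p i; rewrite bocc_close_command cc /=; case: p; rewrite ?addn1.
  + move=> k; rewrite focc_close_command.
    by have := fc k; rewrite in_domf_set; case: eqP => //= _; rewrite mul1n.
- move=> x c N G xG _ [ac cc fc]; split=> /=.
  + rewrite affine_close_command ac bocc_close_command cc /= mul1n andbT.
    by apply: leq_trans (fc _) _; case: (_ \in _).
  + by move=> p i; rewrite bocc_close_command cc /=; case: p; rewrite ?addn1.
  + move=> k; rewrite focc_close_command.
    by have := fc k; rewrite in_domf_set; case: eqP => //= _; rewrite mul1n.
- move=> V V' A B G D dGD _ /term_of_value_affine_in[aV cV fV].
  move=> _ /term_of_value_affine_in[aV' cV' fV']; split.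
  + by rewrite /= aV.
  + by move=> p i /=; rewrite cV cV'.
  + by move=> k; exact: (focc_cat _ _ _ _ _ dGD (fV k) (fV' k)).
- move=> k k' c A B G kk' kG k'G _ [ac cc fc].
  have fle q : focc_command q c <= 1.
    by apply: leq_trans (fc q) _; case: (_ \in _).
  (* As [k] and [k'] differ, closing [k] leaves the free occurrences of [k'] in place, so the two
     binders get the counts of [k] and of [k'] in [c]. *)
  have k'k : (k' == k) = false by rewrite eq_sym; apply: negbTE.
  split=> /=.
  + rewrite !affine_close_command ac !bocc_close_command !cc.
    rewrite focc_close_command k'k /= !eqxx /= !mul1n !add0n andbT.
    case: k k' {kG k'G fc kk' k'k} (fle k) (fle k') => [p x] [p' x'] /=.
    case: p; case: p' => le1 le1' /=;
      by rewrite ?mul1n ?addn0 ?add0n le1 le1'.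
  + move=> p i; rewrite !bocc_close_command cc focc_close_command k'k /=.
    by case: k.1; case: k'.1; case: p; rewrite ?addn0 ?addn1.
  + move=> q; rewrite !focc_close_command.
    have := fc q; rewrite !in_domf_set.
    by case: (q == k'); case: (q == k); rewrite //= !mul1n.
- by move=> V A G _ /term_of_value_affine_in[].
- move=> k c A G kG _ [ac cc fc]; split=> /=.
  + rewrite affine_close_command ac bocc_close_command cc /= eqxx mul1n andbT.
    by apply: leq_trans (fc _) _; case: (_ \in _).
  + move=> p i; rewrite bocc_close_command cc /=.
    by case: k.1; case: p; rewrite ?addn1.
  + move=> q; rewrite focc_close_command.
    by have := fc q; rewrite in_domf_set; case: eqP => //= _; rewrite mul1n.
(* The quantifier rules keep the term and the context. *)
- by [].
- by [].
- move=> t u A G D dGD _ [at' ct ft] _ [au cu fu]; split.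
  + by rewrite /= at'.
  + by move=> p i /=; rewrite ct cu.
  + by move=> k; exact: (focc_cat _ _ _ _ _ dGD (ft k) (fu k)).
(* Conversion changes a formula but not the domain of the context. *)
- move=> c k A B G _ _ _ _ [ac cc fc]; split=> [//|//|q].
  by have := fc q; rewrite !in_domf_set.
- move=> c k A G _ _ _ [ac cc fc]; split=> [//|//|q].
  by apply: leq_trans (fc q) _; rewrite in_domf_set orbC; case: (_ \in _).
Qed.

End Occurrences.

Theorem theorem56 (Kp Kn : Type) (c : command Kp Kn) (G : ctx)
    (hc : derivable c G) :
  exists (n : nat) (c' : command Kp Kn),
    [/\ red0_seq n c c', normal c' & n <= size_command c].
Proof.
have [ac cc _] := typing_affine_in.2 c G hc.
exact: affine_normalizes.
Qed.
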